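(* Suppose that the positive integers $M_1,N_1,M_2,N_2$ satisfy $\gcd(M_1,N_1)=1$, $M_1+N_1\equiv 1 \pmod 2$, $M_1>N_1$ and $M_1^2+N_1^2+N_2^2=M_2^2$. Define the integers $$x=2M_1N_1,\quad y=2M_2N_2,\quad z=M_1^2-N_1^2,\quad w=M_1^2+N_1^2,\quad t=M_1^2+N_1^2+2N_2^2,$$ and the real numbers $$s=\sqrt{x^2+y^2}=\sqrt{(2M_1N_1)^2+(2M_2N_2)^2},\qquad u=\sqrt{y^2+z^2}=\sqrt{(2M_2N_2)^2+(M_1^2-N_1^2)^2}.$$ Then the three-dimensional rectangular parallelepiped characterized by the septuple $(x,y,z,t,s,u,w)$ is a Pythagorean box with a pair of opposite faces which are primitive Pythagorean rectangles, namely those characterized by the triple $(x,z,w)$.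
   Context: A Pythagorean rectangle is a rectangle with integer side lengths and integer diagonal length. It is primitive if the congruent right triangles into which a diagonal cuts it are primitive Pythagorean triangles, i.e. its two side lengths are coprime. A Pythagorean box (PB) is a three-dimensional rectangular box (rectangular parallelepiped) whose edge lengths and inner (space) diagonal length are positive integers. It is characterized by the septuple $(x,y,z,t,s,u,w)$, where $x,y,z$ are the (positive integer) edge lengths, $t$ is the (positive integer) inner diagonal length, so that $x^2+y^2+z^2=t^2$, and $s,u,w$ are the (positive real, not necessarily integer) lengths of the face diagonals, with $s^2 = x^2+y^2$, $u^2=y^2+z^2$, $w^2=x^2+z^2$. The three pairs of opposite congruent faces are characterized by the triples (side, side, diagonal) $(x,z,w)$, $(x,y,s)$ and $(y,z,u)$. Thus the pair of faces $(x,z,w)$ consists of primitive Pythagorean rectangles exactly when $x^2+z^2=w^2$ with $w$ an integer and $\gcd(x,z)=1$. *)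

(* Defs.v *)
From Stdlib Require Export Reals ZArith.

Local Open Scope R_scope.

Definition is_integer (r : R) : Prop := exists n : Z, r = IZR n.

(* The triple (side, side, diagonal). *)
Record rect : Type := Rect { side1 : R; side2 : R; diag : R }.

Definition is_rectangle (q : rect) : Prop :=
  0 < side1 q /\ 0 < side2 q /\ 0 < diag q /\
  side1 q ^ 2 + side2 q ^ 2 = diag q ^ 2.

Definition Pythagorean_rectangle (q : rect) : Prop :=
  is_rectangle q /\
  is_integer (side1 q) /\ is_integer (side2 q) /\ is_integer (diag q).

Definition primitive_Pythagorean_rectangle (q : rect) : Prop :=
  Pythagorean_rectangle q /\
  exists a b : Z, side1 q = IZR a /\ side2 q = IZR b /\ Z.gcd a b = 1%Z.

(* The septuple (x, y, z, t, s, u, w): edges x, y, z, inner diagonal t, and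
   face diagonals s (of the x-y faces), u (y-z faces), w (x-z faces). *)
Record septuple : Type := Septuple {
  edge_x : R; edge_y : R; edge_z : R;
  inner_diag : R;
  diag_xy : R; diag_yz : R; diag_xz : R }.

Definition face_xy (B : septuple) : rect :=
  Rect (edge_x B) (edge_y B) (diag_xy B).
Definition face_yz (B : septuple) : rect :=
  Rect (edge_y B) (edge_z B) (diag_yz B).
Definition face_xz (B : septuple) : rect :=
  Rect (edge_x B) (edge_z B) (diag_xz B).

Definition is_rectangular_box (B : septuple) : Prop :=
  is_rectangle (face_xy B) /\ is_rectangle (face_yz B) /\
  is_rectangle (face_xz B) /\
  0 < inner_diag B /\
  edge_x B ^ 2 + edge_y B ^ 2 + edge_z B ^ 2 = inner_diag B ^ 2.

(* No integrality is required of the face diagonals. *)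
Definition Pythagorean_box (B : septuple) : Prop :=
  is_rectangular_box B /\
  is_integer (edge_x B) /\ is_integer (edge_y B) /\ is_integer (edge_z B) /\
  is_integer (inner_diag B).

(* Main.v *)
Require Import Defs.
From Stdlib Require Import Reals ZArith Znumtheory Lia Lra.

(** The triple [(x, z, w)] is Euclid's parametrization of a primitive Pythagorean triple by
    [M1, N1]; [gcd_pythagorean_legs] gives its coprimality. Since [M2^2 = w + N2^2], one gets [w^2 +
    y^2 = w^2 + 4*N2^2*(w + N2^2) = (w + 2*N2^2)^2 = t^2], so the inner diagonal is an integer. The
    other face diagonals are just square roots. *)

Lemma rel_prime_sub_sqr (a b : Z) :
  rel_prime a b -> rel_prime a (a ^ 2 - b ^ 2)%Z.
Proof.
  intros h.
  destruct (rel_prime_bezout _ _ h) as [p q hpq].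
  apply bezout_rel_prime.
  (* Square the relation p a + q b = 1 and replace b^2 by a^2 - (a^2 - b^2). *)
  apply (Bezout_intro _ _ _ (p ^ 2 * a + 2 * p * q * b + q ^ 2 * a)%Z (- q ^ 2)%Z).
  replace 1%Z with ((p * a + q * b) ^ 2)%Z by (rewrite hpq; reflexivity).
  ring.
Qed.

Lemma rel_prime_2_sub_sqr (a b : Z) :
  ((a + b) mod 2 = 1)%Z -> rel_prime 2 (a ^ 2 - b ^ 2)%Z.
Proof.
  intros h.
  pose proof (Z.div_mod (a + b) 2 ltac:(lia)) as hk.
  rewrite h in hk.
  set (k := ((a + b) / 2)%Z) in hk.
  apply bezout_rel_prime.
  (* a^2 - b^2 = (2k + 1)(2k + 1 - 2b) = 2(2k^2 + 2k - (2k + 1)b) + 1. *)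
  apply (Bezout_intro _ _ _ (- (2 * k * k + 2 * k - (2 * k + 1) * b))%Z 1%Z).
  replace a with (2 * k + 1 - b)%Z by lia.
  ring.
Qed.

(** Each of the factors [2], [a], [b] is coprime to [a^2 - b^2], hence so is their product; only the
    factor [2] needs the parity of [a + b]. *)
Lemma gcd_pythagorean_legs (a b : Z) :
  Z.gcd a b = 1%Z -> ((a + b) mod 2 = 1)%Z ->
  Z.gcd (2 * a * b) (a ^ 2 - b ^ 2) = 1%Z.
Proof.
  intros hab hodd.
  apply Zgcd_1_rel_prime in hab.
  apply Zgcd_1_rel_prime, rel_prime_sym.
  apply rel_prime_mult; [apply rel_prime_mult |]; apply rel_prime_sym.
  - now apply rel_prime_2_sub_sqr.
  - now apply rel_prime_sub_sqr.
  (* With [a] and [b] exchanged the difference of squares changes sign, which the coefficient [- q]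
     absorbs. *)
  - destruct (rel_prime_bezout _ _ (rel_prime_sub_sqr b a (rel_prime_sym _ _ hab)))
      as [p q hpq].
    apply bezout_rel_prime, (Bezout_intro _ _ _ p (- q)%Z).
    rewrite <- hpq; ring.
Qed.

Lemma is_rectangle_sqrt (a b : R) :
  (0 < a)%R -> (0 < b)%R -> is_rectangle (Rect a b (sqrt (a ^ 2 + b ^ 2))).
Proof.
  intros ha hb.
  assert (h : (0 < a ^ 2 + b ^ 2)%R) by nra.
  repeat split; cbn [side1 side2 diag]; auto using sqrt_lt_R0.
  rewrite pow2_sqrt; lra.
Qed.

Lemma is_rectangle_IZR (a b c : Z) :
  (0 < a)%Z -> (0 < b)%Z -> (0 < c)%Z -> (a ^ 2 + b ^ 2 = c ^ 2)%Z ->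
  is_rectangle (Rect (IZR a) (IZR b) (IZR c)).
Proof.
  intros ha hb hc h.
  repeat split; cbn [side1 side2 diag]; auto using IZR_lt.
  rewrite !pow_IZR, <- plus_IZR.
  now f_equal.
Qed.

Theorem mainTheorem2 (M1 N1 M2 N2 : Z)
  (hM1 : (0 < M1)%Z) (hN1 : (0 < N1)%Z) (hM2 : (0 < M2)%Z) (hN2 : (0 < N2)%Z)
  (hgcd : Z.gcd M1 N1 = 1%Z)
  (hpar : ((M1 + N1) mod 2 = 1 mod 2)%Z)
  (hlt : (M1 > N1)%Z)
  (hsq : (M1 ^ 2 + N1 ^ 2 + N2 ^ 2 = M2 ^ 2)%Z) :
  let x := (2 * M1 * N1)%Z in
  let y := (2 * M2 * N2)%Z in
  let z := (M1 ^ 2 - N1 ^ 2)%Z in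
  let w := (M1 ^ 2 + N1 ^ 2)%Z in
  let t := (M1 ^ 2 + N1 ^ 2 + 2 * N2 ^ 2)%Z in
  let s := sqrt (IZR x ^ 2 + IZR y ^ 2) in
  let u := sqrt (IZR y ^ 2 + IZR z ^ 2) in
  let B := Septuple (IZR x) (IZR y) (IZR z) (IZR t) s u (IZR w) in
  Pythagorean_box B /\
  face_xz B = Rect (IZR x) (IZR z) (IZR w) /\
  primitive_Pythagorean_rectangle (face_xz B).
Proof.
  intros x y z w t s u B.
  assert (hx : (0 < x)%Z) by (unfold x; nia).
  assert (hy : (0 < y)%Z) by (unfold y; nia).
  (* This is where [M1 > N1] enters. *)
  assert (hz : (0 < z)%Z) by (unfold z; nia).
  assert (hw : (0 < w)%Z) by (unfold w; nia).
  assert (ht : (0 < t)%Z) by (unfold t; nia).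
  assert (hxz : (x ^ 2 + z ^ 2 = w ^ 2)%Z) by (unfold x, z, w; ring).
  assert (hyw : (x ^ 2 + y ^ 2 + z ^ 2 = t ^ 2)%Z).
  (* This form exposes [M2 ^ 2], so that [hsq] eliminates [M2]. *)
  { replace (y ^ 2)%Z with (4 * M2 ^ 2 * N2 ^ 2)%Z by (unfold y; ring).
    rewrite <- hsq; unfold x, z, t; ring. }
  assert (hface : is_rectangle (face_xz B)) by now apply is_rectangle_IZR.
  assert (hint : forall n, is_integer (IZR n)) by (intros n; now exists n).
  (* What remains after this concerns the inner diagonal and the coprimality of [x] and [z]. *)
  repeat split; try apply hint; try apply hface;
    try (apply is_rectangle_sqrt; now apply IZR_lt).
  - now apply IZR_lt.
  - cbn [edge_x edge_y edge_z inner_diag B].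
    rewrite !pow_IZR, <- !plus_IZR.
    now f_equal.
  - exists x, z; repeat split.
    now apply gcd_pythagorean_legs.
Qed.
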